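(* Let $e_1,\dots,e_n\subseteq\{1,\dots,d\}$ be nonempty and let $F(x)=\frac1n\sum_{i=1}^n f_i(x_{e_i})$, where $x_{e_i}$ denotes the entries of $x\in\mathbb{R}^d$ indexed by $e_i$ (so $f_i$ depends only on the coordinates in $e_i$). Viewed as functions on $\mathbb{R}^d$, suppose the $f_i$ are convex, twice differentiable and $L$-smooth, with Hessians $H_i$ satisfying $\|H_i(x)-H_i(y)\|\le L_H\|x-y\|$ for all $x,y$, and suppose $F$ is $\mu$-strongly convex with $\mu>0$ and unique minimizer $x^*$. Let $$\rho=\frac{\max_{1\le i\le n}\big|\{j\in\{1,\dots,n\}: e_i\cap e_j\ne\emptyset\}\big|}{n}$$ be the sparsity factor. Assume the boundedness assumptions with constants $D,G$ stated in the context. Define $$C=\max\Big\{\frac{32}{\mu^2}\big(L_HLD+3L_HG\big),\;12\Big(1+\frac{L}{\mu}\Big)\Big\}.$$ Let $T\ge2$ be a multiple of $n$ with $\frac{T}{\log T}>Cn$, and run RandomShuffle on $F$ for $T$ iterations with constant step size $\frac{8\log T}{T\mu}$. Then $$\mathbb{E}\big[\|x_T-x^*\|^2\big]\le \mathcal{O}\Big(\frac{1}{T^2}+\frac{\rho^2n^3}{T^3}\Big).$$ That is, there are constants $C_0,q>0$ depending only on $\mu,L,L_H,D,G$ such that the left side is at most $C_0(1+\log T)^q\big(\frac1{T^2}+\frac{\rho^2n^3}{T^3}\big)$.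
   Context: Norms are Euclidean for vectors and spectral for matrices. $f$ is $L$-smooth if $\|\nabla f(x)-\nabla f(y)\|\le L\|x-y\|$ for all $x,y$. $F$ is $\mu$-strongly convex if $F(x)\ge F(y)+\langle\nabla F(y),x-y\rangle+\frac{\mu}{2}\|x-y\|^2$ for all $x,y$. RandomShuffle with step size $\gamma$, run for $T=ln$ iterations ($l$ a positive integer, the number of epochs) from $x_0\in\mathbb{R}^d$: set $x^1_0=x_0$. In each epoch $t=1,\dots,l$ draw a permutation $\sigma_t$ of $\{1,\dots,n\}$ uniformly at random, independently across epochs, and for $k=1,\dots,n$ set $x^t_k=x^t_{k-1}-\gamma\nabla f_{\sigma_t(k)}(x^t_{k-1})$; then put $x^{t+1}_0=x^t_n$. The output is $x_T=x^l_n$. Expectation is over the permutations. Boundedness assumptions: there are constants $D,G>0$ such that, for every realization of the permutations, every iterate $x$ satisfies $\|x-x^*\|\le D$; and $\|\nabla f_i(x)\|\le G$ for all $i$ and all $x$ with $\|x-x^*\|\le D$. Convention: $\mathcal{O}(\cdot)$ hides logarithmic factors and constants depending only on the problem constants, not on $n$, $\rho$ or $T$. *)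

(* Defs.v *)
From HB Require Import structures.
From mathcomp Require Import all_boot all_order all_algebra all_fingroup.
From mathcomp Require Import all_classical all_reals all_analysis.

Set Implicit Arguments.
Unset Strict Implicit.
Unset Printing Implicit Defensive.

Import Order.TTheory GRing.Theory Num.Theory.
Import numFieldNormedType.Exports.

Local Open Scope classical_set_scope.
Local Open Scope ring_scope.

Section Euclidean.
Variables (R : realType) (d : nat).
Implicit Types (x y v : 'rV[R]_d) (A : 'M[R]_d) (f : 'rV[R]_d -> R).

Definition dotv x y : R := \sum_(j < d) x ord0 j * y ord0 j.

(* The library norm `|x| on matrices is the sup norm; it induces the same
   topology, hence the same notion of differentiability. *)
Definition enorm x : R := Num.sqrt (dotv x x).

(* The Euclidean operator norm; the transposition in v *m A is harmless. *)
Definition spectral_norm A : R :=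
  sup [set enorm (v *m A) | v in [set v | enorm v <= 1]].

Definition grad f x : 'rV[R]_d := \row_j 'D_(delta_mx ord0 j) f x.

Definition hessian f x : 'M[R]_d := 'J (grad f) x.

Definition twice_differentiable f : Prop :=
  (forall x, differentiable f x) /\ (forall x, differentiable (grad f) x).

Definition smooth (L : R) f : Prop :=
  forall x y, enorm (grad f x - grad f y) <= L * enorm (x - y).

Definition hessian_lipschitz (LH : R) f : Prop :=
  forall x y, spectral_norm (hessian f x - hessian f y) <= LH * enorm (x - y).

Definition strongly_convex (mu : R) f : Prop :=
  forall x y,
    f x >= f y + dotv (grad f y) (x - y) + mu / 2 * enorm (x - y) ^+ 2.

Definition unique_minimizer f xs : Prop :=
  (forall x, f xs <= f x) /\ (forall y, (forall x, f y <= f x) -> y = xs).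

End Euclidean.

(* A function of the coordinates in e only, viewed as a function on R^d;
   enum_val lists the elements of e in increasing order. *)
Definition on_coords (R : realType) (d : nat) (e : {set 'I_d})
    (g : 'rV[R]_#|e| -> R) : 'rV[R]_d -> R :=
  fun x => g (colsub (@enum_val 'I_d (mem e)) x).

Definition finite_sum_avg (R : realType) (d n : nat)
    (f : 'I_n -> 'rV[R]_d -> R) : 'rV[R]_d -> R :=
  fun x => n%:R^-1 * \sum_(i < n) f i x.

Definition sparsity (R : realType) (d n : nat) (e : 'I_n -> {set 'I_d}) : R :=
  (\max_(i < n) #|[set j : 'I_n | e i :&: e j != finset.set0]%SET|)%:R / n%:R.

Section RandomShuffle.
Variables (R : realType) (d n l : nat).
Variables (f : 'I_n -> 'rV[R]_d -> R) (gamma : R) (x0 : 'rV[R]_d).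
Implicit Types (s : 'S_n) (sigma : l.-tuple 'S_n) (x : 'rV[R]_d).

Definition sgd_step x (i : 'I_n) : 'rV[R]_d := x - gamma *: grad (f i) x.

(* The first k steps of an epoch that starts at x and visits
   s 0, s 1, ..., s (n - 1) in this order. *)
Definition epoch_prefix s x (k : nat) : 'rV[R]_d :=
  foldl sgd_step x (take k [seq s j | j <- enum 'I_n]).

Definition epoch s x : 'rV[R]_d := epoch_prefix s x n.

Definition epoch_start sigma (t : nat) : 'rV[R]_d :=
  foldl (fun x s => epoch s x) x0 (take t sigma).

(* Epochs are numbered from 0: this is x^(t+1)_k, for 0 <= k <= n. *)
Definition shuffle_iterate sigma (t : 'I_l) (k : nat) : 'rV[R]_d :=
  epoch_prefix (tnth sigma t) (epoch_start sigma t) k.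

Definition shuffle_output sigma : 'rV[R]_d := epoch_start sigma l.

End RandomShuffle.

(* Independent uniform permutations in the l epochs amount to a uniform element
   of l.-tuple 'S_n. *)
Definition uniform_expectation (R : realType) (Omega : finType)
    (X : Omega -> R) : R :=
  #|Omega|%:R^-1 * \sum_(w : Omega) X w.

(* Main.v *)
Require Import Defs.
From HB Require Import structures.
From mathcomp Require Import all_boot all_order all_algebra all_fingroup.
From mathcomp Require Import all_classical all_reals all_analysis.
From mathcomp Require Import ring lra.

Set Implicit Arguments.
Unset Strict Implicit.
Unset Printing Implicit Defensive.

Import Order.TTheory GRing.Theory Num.Theory.
Import numFieldNormedType.Exports.

Local Open Scope classical_set_scope.
Local Open Scope ring_scope.

(** Write [h = n * gamma] and let [x] be the start of an epoch. Up to first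
    order an epoch is one gradient step of length [h] on the average [F]; the
    proof rests on identifying its mean to second order.

    The epoch equals [x - h *: grad F x - gamma *: drift], where the drift
    collects, for each visited component, the change of its gradient caused by
    the components visited earlier. To leading order the drift is
    [- gamma] times the sum, over pairs (j before k), of
    [grad f_j *m hessian f_k] taken at [x]. Pairing each permutation with its
    reversal ([vmean_frozen_drift]), its mean is half the sum over all ordered
    pairs [j != k]. With the diagonal included, that sum factors through
    [n *: grad F], and the Hessian-vector products can be traded for
    [grad F (x - h *: grad F x) - grad F x]. So the mean of an epoch is, up to a
    bias, the Heun step [x - (h / 2) *: (grad F x + grad F (x - h *: grad F x))]
    ([vmean_drift_heun]).

    The Heun step is the midpoint of [x] and of two successive gradient steps
    from [x], hence inherits their contraction towards the minimizer
    ([heun_step_contract]).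

    Sparsity enters through one fact: the coordinates read by a component are
    moved only by the at most [m = rho * n] components that share a coordinate
    with it. Hence the drift has norm O(gamma * n * m), which bounds the
    variance of an epoch, and the second-order approximation is off by
    O(gamma ^+ 2 * n * m ^+ 2). The missing diagonal pairs contribute a bias
    O(gamma * n), without any factor [m]: this is the origin of the term
    [1 / T ^+ 2].

    Altogether ([epoch_contraction]) the expected squared distance to the
    minimizer is multiplied by at most [1 - h * mu / 2] per epoch, up to an
    additive error. Over [l] epochs ([uniform_expectation_foldl_le]) the initial
    squared distance is damped by a factor [T ^- 4] owing to the step size, and
    the fixed point of the recursion is O(gamma ^+ 2 + gamma ^+ 3 * m ^+ 2 * n)
    ([fixed_point_le]), which is the claimed rate since
    [m ^+ 2 * n = rho ^+ 2 * n ^+ 3]. *)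

(** * Euclidean norm and operator norm *)

Section EuclideanTheory.
Variables (R : realType) (d : nat).
Implicit Types (x y z u v : 'rV[R]_d) (a c : R).

Lemma dotvC x y : dotv x y = dotv y x.
Proof. by apply: eq_bigr => j _; rewrite mulrC. Qed.

Lemma dotvDl x y z : dotv (x + y) z = dotv x z + dotv y z.
Proof. by rewrite -big_split; apply: eq_bigr => j _; rewrite mxE mulrDl. Qed.

Lemma dotvZl a x y : dotv (a *: x) y = a * dotv x y.
Proof. by rewrite mulr_sumr; apply: eq_bigr => j _; rewrite mxE mulrA. Qed.

Lemma dotvDr x y z : dotv x (y + z) = dotv x y + dotv x z.
Proof. by rewrite dotvC dotvDl !(dotvC x). Qed.

Lemma dotvZr a x y : dotv x (a *: y) = a * dotv x y.
Proof. by rewrite dotvC dotvZl dotvC. Qed.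

Lemma dotvNr x y : dotv x (- y) = - dotv x y.
Proof. by rewrite -scaleN1r dotvZr mulN1r. Qed.

Lemma dotvBr x y z : dotv x (y - z) = dotv x y - dotv x z.
Proof. by rewrite dotvDr dotvNr. Qed.

Lemma dotvBl x y z : dotv (x - y) z = dotv x z - dotv y z.
Proof. by rewrite dotvC dotvBr !(dotvC z). Qed.

Lemma dotv0 x : dotv x 0 = 0.
Proof. by rewrite -(scale0r x) dotvZr mul0r. Qed.

Lemma dotv_sumr (I : finType) x (F : I -> 'rV[R]_d) :
  dotv x (\sum_i F i) = \sum_i dotv x (F i).
Proof.
by apply: (big_morph (dotv x)); [move=> y z; rewrite dotvDr | rewrite dotv0].
Qed.

Lemma dotvv_ge0 x : 0 <= dotv x x.
Proof. by apply: sumr_ge0 => j _; rewrite -expr2 sqr_ge0. Qed.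

Lemma enorm_ge0 x : 0 <= enorm x.
Proof. exact: sqrtr_ge0. Qed.

Lemma enorm_sqr x : enorm x ^+ 2 = dotv x x.
Proof. by rewrite sqr_sqrtr ?dotvv_ge0. Qed.

Lemma enormZ a x : enorm (a *: x) = `|a| * enorm x.
Proof.
by rewrite /enorm dotvZl dotvZr mulrA -expr2 sqrtrM ?sqr_ge0 // sqrtr_sqr.
Qed.

Lemma enormN x : enorm (- x) = enorm x.
Proof. by rewrite -scaleN1r enormZ normrN1 mul1r. Qed.

Lemma enormBC x y : enorm (x - y) = enorm (y - x).
Proof. by rewrite -enormN opprB. Qed.

Lemma enorm0 : enorm (0 : 'rV[R]_d) = 0.
Proof. by rewrite -(scale0r 0) enormZ normr0 mul0r. Qed.

Lemma enorm_eq0 x : (enorm x == 0) = (x == 0).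
Proof.
apply/idP/eqP => [|->]; last by rewrite enorm0.
rewrite -sqrf_eq0 enorm_sqr /dotv => /eqP x0.
apply/rowP => j; rewrite mxE; apply/eqP; rewrite -sqrf_eq0 expr2.
by apply/eqP; apply: (psumr_eq0P _ x0) => // i _; rewrite -expr2 sqr_ge0.
Qed.

Lemma enorm_sqrD x y :
  enorm (x + y) ^+ 2 = enorm x ^+ 2 + 2 * dotv x y + enorm y ^+ 2.
Proof. by rewrite !enorm_sqr dotvDl !dotvDr (dotvC y x); ring. Qed.

Lemma enorm_sqrB x y :
  enorm (x - y) ^+ 2 = enorm x ^+ 2 - 2 * dotv x y + enorm y ^+ 2.
Proof. by rewrite enorm_sqrD dotvNr enormN; ring. Qed.

Lemma cauchy_schwarz x y : dotv x y <= enorm x * enorm y.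
Proof.
have [->|x0] := eqVneq x 0; first by rewrite dotvC dotv0 enorm0 mul0r.
have [->|y0] := eqVneq y 0; first by rewrite dotv0 enorm0 mulr0.
have ab : 0 < enorm x * enorm y.
  by rewrite mulr_gt0 // lt_def enorm_ge0 enorm_eq0 ?x0 ?y0.
have := sqr_ge0 (enorm (enorm y *: x - enorm x *: y)).
rewrite enorm_sqrB !enormZ !ger0_norm ?enorm_ge0 // dotvZl dotvZr => h.
rewrite -(ler_pM2l ab); nra.
Qed.

Lemma enormD x y : enorm (x + y) <= enorm x + enorm y.
Proof.
rewrite -ler_sqr ?nnegrE ?addr_ge0 ?enorm_ge0 // enorm_sqrD.
have := cauchy_schwarz x y; nra.
Qed.

Lemma enormB x y : enorm (x - y) <= enorm x + enorm y.
Proof. by rewrite -(enormN y) enormD. Qed.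

Lemma enorm_sum (I : finType) (P : pred I) (F : I -> 'rV[R]_d) :
  enorm (\sum_(i | P i) F i) <= \sum_(i | P i) enorm (F i).
Proof.
elim/big_ind2: _ => [|x a y c xa yc|//]; first by rewrite enorm0.
exact: le_trans (enormD _ _) (lerD xa yc).
Qed.

(** Testing [x] against itself recovers its norm, so a bound on all scalar
    products is a bound on the norm. *)
Lemma enorm_le_dual x c :
  0 <= c -> (forall u, dotv u x <= c * enorm u) -> enorm x <= c.
Proof.
move=> c0 /(_ x); rewrite -enorm_sqr expr2.
have [->|x0] := eqVneq x 0; first by rewrite enorm0.
by rewrite ler_pM2r // lt_def enorm_ge0 enorm_eq0 x0.
Qed.

Lemma exists_enorm_gt0 : (0 < d)%N -> exists v : 'rV[R]_d, 0 < enorm v.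
Proof.
move=> d0; exists (delta_mx ord0 (Ordinal d0)).
rewrite lt_def enorm_ge0 enorm_eq0 andbT; apply/eqP => /rowP /(_ (Ordinal d0)).
by rewrite !mxE !eqxx => /eqP; rewrite oner_eq0.
Qed.

(** [sup] of an unbounded set is a default value, so every use of
    [spectral_norm] as an operator norm rests on this. *)
Lemma spectral_norm_has_sup (A : 'M[R]_d) :
  has_sup [set enorm (v *m A) | v in [set v : 'rV[R]_d | enorm v <= 1]].
Proof.
split; first by exists (enorm (0 *m A)), 0; rewrite //= enorm0.
exists (\sum_(i < d) enorm (row i A)) => _ [v /= v1 <-].
rewrite mulmx_sum_row; apply: (le_trans (enorm_sum _ _)); apply: ler_sum => i _.
rewrite enormZ ler_piMl ?enorm_ge0 //; apply: le_trans v1.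
rewrite -ler_sqr ?nnegrE ?enorm_ge0 // enorm_sqr real_normK ?num_real //.
rewrite /dotv (bigD1 i) //= -expr2 lerDl.
by apply: sumr_ge0 => j _; rewrite -expr2 sqr_ge0.
Qed.

Lemma spectral_norm_ge0 (A : 'M[R]_d) : 0 <= spectral_norm A.
Proof.
apply: ub_le_sup; first by have [] := spectral_norm_has_sup A.
by exists 0; rewrite /= ?mul0mx ?enorm0.
Qed.

Lemma enorm_mulmx (A : 'M[R]_d) v :
  enorm (v *m A) <= spectral_norm A * enorm v.
Proof.
have [->|v0] := eqVneq v 0; first by rewrite mul0mx enorm0 mulr0.
have vp : 0 < enorm v by rewrite lt_def enorm_ge0 enorm_eq0 v0.
rewrite -ler_pdivrMr //.
apply: ub_le_sup; first by have [] := spectral_norm_has_sup A.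
have ? : 0 <= (enorm v)^-1 by rewrite invr_ge0 ltW.
exists ((enorm v)^-1 *: v); rewrite /= -?scalemxAl enormZ ger0_norm //.
  by rewrite mulVf ?gt_eqF.
by rewrite mulrC.
Qed.

Lemma hessian_lipschitz_ge0 (f : 'rV[R]_d -> R) (LH : R) :
  (0 < d)%N -> hessian_lipschitz LH f -> 0 <= LH.
Proof.
move=> /exists_enorm_gt0[v v0] /(_ v 0); rewrite subr0 => lh.
by rewrite -(pmulr_lge0 _ v0) (le_trans (spectral_norm_ge0 _) lh).
Qed.

End EuclideanTheory.

(** * Calculus along a line *)

Section LineCalculus.
Variables (R : realType) (d : nat).
Implicit Types (x y u v : 'rV[R]_d) (f : 'rV[R]_d -> R).

Lemma is_derive_line (W : normedModType R) (F : 'rV[R]_d -> W) x v (t : R) :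
  differentiable F (x + t *: v) ->
  is_derive t 1 (fun s : R => F (x + s *: v)) ('D_v F (x + t *: v)).
Proof.
move=> /(diff_derivable (v := v)) dF.
have E : (fun h : R => h^-1 *: (F (x + (h *: 1 + t) *: v) - F (x + t *: v)))
       = (fun h => h^-1 *: (F (h *: v + (x + t *: v)) - F (x + t *: v))).
  by apply/funext => h; rewrite [h *: 1]mulr1 scalerDl addrCA.
by apply: DeriveDef; [rewrite /derivable E | rewrite /derive E].
Qed.

Lemma derive_dotv_grad f x v :
  differentiable f x -> 'D_v f x = dotv (grad f x) v.
Proof.
move=> df; rewrite deriveE // {1}[v]row_sum_delta linear_sum.
by apply: eq_bigr => j _; rewrite linearZ mxE deriveE // mulrC.
Qed.

Lemma is_derive_dotv u (G : R -> 'rV[R]_d) (t : R) (dG : 'rV[R]_d) :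
  is_derive t 1 G dG -> is_derive t 1 (fun s => dotv u (G s)) (dotv u dG).
Proof.
move=> dGt; have vG : derivable G t 1 by [].
have cG j : is_derive t 1 (fun s => G s ord0 j) (dG ord0 j).
  apply: DeriveDef; first by move/derivable_mxP: vG; apply.
  by rewrite -(derive_val (f := G) (df := dG)) derive_mx // mxE.
rewrite (_ : (fun s => _) = \sum_(j < d) (fun s => u ord0 j *: G s ord0 j)).
  exact: is_derive_sum.
by apply/funext => s; rewrite fct_sumE.
Qed.

(** Integrating an affine bound on the derivative, as the mean value theorem
    for [phi] minus the antiderivative of the bound. *)
Lemma le_affine_derive (phi dphi : R -> R) (a b : R) :
  (forall t : R, is_derive t 1 phi (dphi t)) ->
  (forall t, 0 <= t -> dphi t <= a + b * t) ->
  phi 1 <= phi 0 + a + b / 2.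
Proof.
move=> dphiP le_dphi.
pose psi t := phi t - (a * t + b / 2 * t ^+ 2).
have dpsi (t : R) : is_derive t 1 psi (dphi t - (a + b * t)).
  apply: is_derive_eq; rewrite /GRing.scale /=; lra.
have cpsi : {within `[0, 1], continuous psi}.
  by apply: derivable_within_continuous => t _; have [] := dpsi t.
have [c c01 psi01] := MVT ltr01 (fun t _ => dpsi t) cpsi.
have c0 : 0 <= c by move: c01; rewrite in_itv /= => /andP[/ltW].
have := le_dphi c c0; move: psi01; rewrite /psi; lra.
Qed.

(** The factor [1 / 2] matters: it is what lets [gradient_step_contract] reach
    step sizes [h] with [h * L <= 2 / 3]. *)
Lemma descent (L : R) f x v :
  (forall z, differentiable f z) -> smooth L f ->
  f (x + v) <= f x + dotv (grad f x) v + L / 2 * enorm v ^+ 2.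
Proof.
move=> df sf.
have dline (t : R) : is_derive t 1 (fun s : R => f (x + s *: v))
                 (dotv (grad f (x + t *: v)) v).
  by rewrite -derive_dotv_grad //; apply: is_derive_line.
have := le_affine_derive (a := dotv (grad f x) v) (b := L * enorm v ^+ 2) dline.
rewrite scale1r scale0r addr0 mulrAC; apply => t t0.
rewrite -lerBlDl -dotvBl; apply: le_trans (cauchy_schwarz _ _) _.
apply: le_trans (ler_wpM2r (enorm_ge0 _) (sf _ _)) _.
by rewrite [x + _ - x]addrC addKr enormZ ger0_norm //; lra.
Qed.

(** A norm bound on a vector-valued remainder: test it against each [u] and
    use the scalar mean value theorem on the resulting function of one real. *)
Lemma taylor_grad (LH : R) f x v :
  0 <= LH -> (forall z, differentiable (grad f) z) -> hessian_lipschitz LH f ->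
  enorm (grad f (x + v) - grad f x - v *m hessian f x)
  <= LH / 2 * enorm v ^+ 2.
Proof.
move=> LH0 dg lh; apply: enorm_le_dual => [|u].
  by rewrite mulr_ge0 ?sqr_ge0 ?divr_ge0.
have dline (t : R) : is_derive t 1 (fun s : R => dotv u (grad f (x + s *: v)))
                 (dotv u (v *m hessian f (x + t *: v))).
  rewrite -deriveEjacobian //.
  by apply: is_derive_dotv; apply: is_derive_line.
have := le_affine_derive (a := dotv u (v *m hessian f x))
          (b := LH * enorm v ^+ 2 * enorm u) dline.
rewrite scale1r scale0r addr0 !dotvBr => le_line.
suff {}/le_line : forall t : R, 0 <= t ->
    dotv u (v *m hessian f (x + t *: v))
    <= dotv u (v *m hessian f x) + LH * enorm v ^+ 2 * enorm u * t by lra.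
move=> t t0.
rewrite -lerBlDl -dotvBr -mulmxBr; apply: le_trans (cauchy_schwarz _ _) _.
have := lh (x + t *: v) x; rewrite [x + _ - x]addrC addKr enormZ.
rewrite ger0_norm // => lht.
apply: le_trans (ler_wpM2l (enorm_ge0 _) (enorm_mulmx _ _)) _.
apply: le_trans (ler_wpM2l (enorm_ge0 _) (ler_wpM2r (enorm_ge0 _) lht)) _.
lra.
Qed.

(** Along [t *: v] the increment of the gradient and its linear part
    [t *: (v *m hessian f x)] agree up to O(t ^+ 2), so the Lipschitz bound on
    the former passes to the latter as [t] tends to 0. *)
Lemma enorm_mulmx_hessian (L LH : R) f x v :
  0 <= LH -> (forall z, differentiable (grad f) z) ->
  smooth L f -> hessian_lipschitz LH f ->
  enorm (v *m hessian f x) <= L * enorm v.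
Proof.
move=> LH0 dg sf lh; apply/ler_addgt0Pr => eps eps0.
pose c := LH / 2 * enorm v ^+ 2.
have c0 : 0 <= c by rewrite mulr_ge0 ?sqr_ge0 ?divr_ge0.
pose t := eps / (c + 1).
have t0 : 0 < t by rewrite divr_gt0 // ltr_wpDl.
have ct : t * c <= eps.
  by rewrite /t mulrAC ler_pdivrMr ?ltr_wpDl // ler_pM2l // lerDl.
rewrite -(ler_pM2l t0).
have -> : t * enorm (v *m hessian f x) = enorm ((t *: v) *m hessian f x).
  by rewrite -scalemxAl enormZ gtr0_norm.
have := taylor_grad x (t *: v) LH0 dg lh.
have := sf (x + t *: v) x.
rewrite [x + _ - x]addrC addKr !enormZ gtr0_norm // => h1 h2.
have := enormB (grad f (x + t *: v) - grad f x)
  (grad f (x + t *: v) - grad f x - t *: v *m hessian f x).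
rewrite opprB [X in enorm X](_ : _ = t *: v *m hessian f x); last first.
  by rewrite addrC subrK.
have : t * (t * c) <= t * eps by rewrite ler_pM2l.
rewrite addrC in h1 h2 *; rewrite /c; nra.
Qed.

End LineCalculus.

(** * Functions of few coordinates and their averages *)

Section Sparsity.
Variables (R : realType) (d : nat).
Implicit Types (x y v : 'rV[R]_d) (e : {set 'I_d}).

(** A matrix rather than a function on vectors, so that it composes with
    Hessians and its linearity comes for free. *)
Definition coord_mask e : 'M[R]_d := diag_mx (\row_j (j \in e)%:R).

Lemma mulmx_coord_mask e v j :
  (v *m coord_mask e) ord0 j = v ord0 j *+ (j \in e).
Proof. by rewrite mul_mx_diag !mxE mulr_natr. Qed.

Lemma enorm_mask e v : enorm (v *m coord_mask e) <= enorm v.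
Proof.
rewrite ler_sqrt ?dotvv_ge0 //; apply: ler_sum => j _.
rewrite mulmx_coord_mask; case: (j \in e) => //.
by rewrite mulr0n mulr0 -expr2 sqr_ge0.
Qed.

Lemma on_coords_eq e (g : 'rV[R]_#|e| -> R) x y :
  (forall j, j \in e -> x ord0 j = y ord0 j) -> on_coords g x = on_coords g y.
Proof.
move=> xy; rewrite /on_coords; congr g.
by apply/rowP => k; rewrite !mxE xy //; apply: enum_valP.
Qed.

Lemma grad_on_coords_eq e (g : 'rV[R]_#|e| -> R) x y :
  (forall j, j \in e -> x ord0 j = y ord0 j) ->
  grad (on_coords g) x = grad (on_coords g) y.
Proof.
move=> xy; apply/rowP => j; rewrite !mxE /derive (on_coords_eq _ xy).
pose q z h := h^-1 *: ((on_coords g \o shift z) (h *: delta_mx ord0 j)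
                       - on_coords g y).
rewrite -/(q x) -/(q y) (_ : q x = q y) //; apply/funext => h.
congr (_ *: (_ - _)); apply: on_coords_eq => k ke.
by rewrite mxE [RHS]mxE xy.
Qed.

(** Only the part of a displacement inside [e] is seen by the component. With
    [grad_on_coords_disjoint] this is all that is used of sparsity. *)
Lemma grad_on_coords_mask e (g : 'rV[R]_#|e| -> R) x v :
  grad (on_coords g) (x + v *m coord_mask e) = grad (on_coords g) (x + v).
Proof.
by apply: grad_on_coords_eq => j je; rewrite mxE mulmx_coord_mask je mxE.
Qed.

Lemma grad_on_coords_out e (g : 'rV[R]_#|e| -> R) x (j : 'I_d) :
  j \notin e -> grad (on_coords g) x ord0 j = 0.
Proof.
move=> je; rewrite mxE /derive.
rewrite (_ : (fun h => _) = fun=> 0) ?lim_cst //.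
apply/funext => h /=.
rewrite [X in _ - X](_ : _ = on_coords g (h *: delta_mx ord0 j + x)).
  by rewrite subrr scaler0.
apply: on_coords_eq => k ke; rewrite !mxE eqxx.
by rewrite (_ : k == j = false) ?mulr0 ?add0r //; apply: contraNF je => /eqP <-.
Qed.

Lemma grad_on_coords_disjoint e e' (g : 'rV[R]_#|e'| -> R) x :
  (e :&: e' = finset.set0)%SET -> grad (on_coords g) x *m coord_mask e = 0.
Proof.
move=> ee; apply/rowP => j; rewrite mulmx_coord_mask [RHS]mxE.
have [je|//] := boolP (j \in e).
rewrite grad_on_coords_out ?mul0rn //; apply/negP => je'.
by have := finset.in_set0 j; rewrite -ee finset.in_setI je je'.
Qed.

End Sparsity.

Section Averages.
Variables (R : realType) (d n : nat) (f : 'I_n -> 'rV[R]_d -> R).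
Hypothesis df : forall i x, differentiable (f i) x.
Let F := finite_sum_avg f.

Let FE : F = n%:R^-1 \*: \sum_(i < n) f i.
Proof. by apply/funext => x; rewrite /F /finite_sum_avg /= fct_sumE. Qed.

Lemma differentiable_finite_sum_avg x : differentiable F x.
Proof. by rewrite FE; apply: differentiableZ; apply: differentiable_sum. Qed.

Lemma grad_finite_sum_avg x : grad F x = n%:R^-1 *: \sum_(i < n) grad (f i) x.
Proof.
apply/rowP => j; rewrite !mxE summxE FE.
have dfj i : derivable (f i) x (delta_mx ord0 j) by apply: diff_derivable.
rewrite deriveZ; last exact: derivable_sum.
rewrite derive_sum //; congr (_ * _).
by apply: eq_bigr => i _; rewrite mxE.
Qed.

Lemma smooth_finite_sum_avg (L : R) :
  (0 < n)%N -> (forall i, smooth L (f i)) -> smooth L F.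
Proof.
move=> n0 sf x y; rewrite !grad_finite_sum_avg -scalerBr -sumrB enormZ.
rewrite ger0_norm ?invr_ge0 // ler_pdivrMl ?ltr0n //.
apply: le_trans (enorm_sum _ _) _.
apply: (@le_trans _ _ (\sum_(i < n) L * enorm (x - y))).
  by apply: ler_sum => i _; apply: sf.
by rewrite sumr_const card_ord mulr_natl.
Qed.

End Averages.

(** * Gradient steps and Heun steps for a strongly convex function *)

Section GradientSteps.
Variables (R : realType) (d : nat) (F : 'rV[R]_d -> R) (mu L : R).
Variable xs : 'rV[R]_d.
Hypotheses (dF : forall x, differentiable F x) (sF : smooth L F).
Hypotheses (mu_gt0 : 0 < mu) (scF : strongly_convex mu F).
Hypothesis xs_min : forall x, F xs <= F x.
Implicit Types x y : 'rV[R]_d.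

Lemma strongly_convex_monotone x y :
  mu * enorm (x - y) ^+ 2 <= dotv (grad F x - grad F y) (x - y).
Proof.
have := scF x y; have := scF y x.
rewrite (enormBC y) -(opprB x y) dotvNr dotvBl; lra.
Qed.

Lemma strong_convexity_le_smoothness : (0 < d)%N -> mu <= L.
Proof.
move=> /(exists_enorm_gt0 R)[v v0].
have := le_trans (strongly_convex_monotone v 0) (cauchy_schwarz _ _).
have := sF v 0; rewrite subr0 => h1 h2.
have := le_trans h2 (ler_wpM2r (enorm_ge0 v) h1).
by rewrite -mulrA -expr2 ler_pM2r // exprn_gt0.
Qed.

Hypothesis L_gt0 : 0 < L.

(** Compare [F xs] with the value after one gradient step of length [1 / L]. *)
Lemma enorm_grad_sqr x : enorm (grad F x) ^+ 2 <= 2 * L * (F x - F xs).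
Proof.
have := descent x (- L^-1 *: grad F x) dF sF.
rewrite enormZ dotvZr -enorm_sqr normrN gtr0_norm ?invr_gt0 // exprMn => h.
have := le_trans (xs_min _) h; set G := enorm _ ^+ 2 => {}h.
have E : L / 2 * (L^-1 ^+ 2 * G) = L^-1 * G / 2 by field; rewrite gt_eqF.
have : L^-1 * G <= 2 * (F x - F xs) by rewrite E in h; lra.
by rewrite ler_pdivrMl // mulrCA mulrA.
Qed.

Lemma grad_minimizer : grad F xs = 0.
Proof.
have := enorm_grad_sqr xs; rewrite subrr mulr0 => h.
apply/eqP; rewrite -enorm_eq0 -sqrf_eq0 eq_le h sqr_ge0 //.
Qed.

(** The loss [h ^+ 2 * |grad F x| ^+ 2] is paid out of the gain
    [2 * h * <x - xs, grad F x>]: by [enorm_grad_sqr] and strong convexity it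
    costs at most a fraction [h * L] of it. *)
Lemma gradient_step_contract (h : R) x : 0 <= h -> h * L <= 2 / 3 ->
  enorm (x - h *: grad F x - xs) ^+ 2
  <= (1 - 4 / 3 * (h * mu)) * enorm (x - xs) ^+ 2.
Proof.
move=> h0 hL; rewrite [x - _ - xs]addrAC [enorm (_ - _ *: _) ^+ 2]enorm_sqrB.
rewrite dotvZr enormZ ger0_norm // exprMn.
have := enorm_grad_sqr x; have := scF xs x.
have := strongly_convex_monotone x xs.
rewrite grad_minimizer subr0 (enormBC xs) -(opprB x xs) dotvNr.
rewrite (dotvC _ (x - xs)).
set W := enorm (x - xs) ^+ 2; set G := enorm _ ^+ 2.
set p := dotv _ _; set D := F x - F xs => h1 h2 h3.
have W0 : 0 <= W by apply: sqr_ge0.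
have hG : G <= 2 * L * (p - mu / 2 * W).
  apply: le_trans h3 _; rewrite ler_pM2l ?mulr_gt0 // /D; lra.
have h2G : h ^+ 2 * G <= h ^+ 2 * (2 * L * (p - mu / 2 * W)).
  by rewrite ler_wpM2l // sqr_ge0.
have s1 : h * (1 - h * L) * (mu * W) <= h * (1 - h * L) * p.
  by rewrite ler_wpM2l // mulr_ge0 //; lra.
have s2 : (h * L) * (h * mu * W) <= 2 / 3 * (h * mu * W).
  by rewrite ler_wpM2r // (mulr_ge0 _ W0) // mulr_ge0 // ltW.
move: h2G s1 s2; rewrite expr2; lra.
Qed.

Fact heun_midpoint (h : R) (x a b c : 'rV[R]_d) :
  x - (h / 2) *: (a + b) - c
  = 2^-1 *: ((x - c) + (x - h *: a - h *: b - c)).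
Proof.
apply/rowP => j; rewrite !mxE.
move: (x _ _) (a _ _) (b _ _) (c _ _) => u v w z; lra.
Qed.

(** Heun's step is the midpoint of [x] and of two successive gradient steps,
    so it inherits half of their contraction. *)
Lemma heun_step_contract (h : R) x : 0 <= h -> h * L <= 2 / 3 ->
  enorm (x - (h / 2) *: (grad F x + grad F (x - h *: grad F x)) - xs)
  <= (1 - 2 / 3 * (h * mu)) * enorm (x - xs).
Proof.
move=> h0 hL; set y := x - h *: grad F x; set q := 1 - 4 / 3 * (h * mu).
have c1 := gradient_step_contract x h0 hL.
have c2 := gradient_step_contract y h0 hL.
have [w0|w0] := eqVneq (enorm (x - xs)) 0.
  have xxs : x = xs by apply/eqP; rewrite -subr_eq0 -enorm_eq0 w0.
  by rewrite /y xxs grad_minimizer !(scaler0, subr0, addr0) grad_minimizer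
             !(scaler0, subr0, addr0) subrr enorm0 mulr0.
have q0 : 0 <= q.
  have wp : 0 < enorm (x - xs) ^+ 2.
    by rewrite exprn_gt0 // lt_def enorm_ge0 w0.
  by rewrite -(pmulr_lge0 _ wp) (le_trans (sqr_ge0 _) c1).
have c3 : enorm (y - h *: grad F y - xs) <= q * enorm (x - xs).
  rewrite -ler_sqr ?nnegrE ?mulr_ge0 ?enorm_ge0 // (le_trans c2) //.
  by rewrite exprMn [q ^+ 2]expr2 -[q * q * _]mulrA ler_wpM2l.
rewrite heun_midpoint -/y.
rewrite enormZ ger0_norm ?invr_ge0 //.
rewrite ler_pdivrMl //.
apply: le_trans (enormD _ _) _; apply: le_trans (lerD (lexx _) c3) _.
by rewrite /q; move: (enorm _) (h * mu) => a b {c1 c2 c3}; lra.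
Qed.

End GradientSteps.

(** * Uniform expectations *)

Section UniformExpectation.
Variable R : realType.

Lemma uniform_expectation_le (Omega : finType) (X Y : Omega -> R) :
  (forall w, X w <= Y w) -> uniform_expectation X <= uniform_expectation Y.
Proof. by move=> XY; rewrite ler_wpM2l ?invr_ge0 //; apply: ler_sum. Qed.

Lemma uniform_expectation_affine (Omega : finType) (X : Omega -> R) (a b : R) :
  (0 < #|Omega|)%N ->
  uniform_expectation (fun w => a * X w + b) = a * uniform_expectation X + b.
Proof.
move=> O0; rewrite /uniform_expectation big_split /= -mulr_sumr sumr_const.
by rewrite mulrDr mulrCA -[b *+ _]mulr_natl mulKf // pnatr_eq0 -lt0n.
Qed.

Lemma uniform_expectation_le_cst (Omega : finType) (X : Omega -> R) (c : R) :
  (0 < #|Omega|)%N -> (forall w, X w <= c) -> uniform_expectation X <= c.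
Proof.
move=> O0 Xc; apply: (@le_trans _ _ (0 * uniform_expectation X + c)).
  rewrite -uniform_expectation_affine //; apply: uniform_expectation_le => w.
  by rewrite mul0r add0r.
by rewrite mul0r add0r.
Qed.

(** Independence of the first draw from the others. *)
Lemma uniform_expectation_tupleS (T : finType) (k : nat)
    (X : k.+1.-tuple T -> R) :
  uniform_expectation X
  = uniform_expectation (fun s : T =>
      uniform_expectation (fun w : k.-tuple T => X [tuple of s :: w])).
Proof.
rewrite /uniform_expectation !card_tuple expnS natrM invfM -mulrA.
congr (_ * _); rewrite -mulr_sumr; congr (_ * _); rewrite pair_big /=.
rewrite (reindex (fun p : T * k.-tuple T => [tuple of p.1 :: p.2])) //=.
exists (fun w : k.+1.-tuple T => (thead w, [tuple of behead w])).
  by move=> [s w] _ /=; congr (_, _); apply: val_inj.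
by move=> w _; rewrite [RHS]tuple_eta; apply: val_inj.
Qed.

End UniformExpectation.

Section VectorMean.
Variables (R : realType) (d : nat) (Omega : finType).
Hypothesis Omega_gt0 : (0 < #|Omega|)%N.
Implicit Types (X Y : Omega -> 'rV[R]_d) (a : 'rV[R]_d).

Definition vmean X : 'rV[R]_d := #|Omega|%:R^-1 *: \sum_w X w.

Let cardU : (#|Omega|%:R : R) != 0.
Proof. by rewrite pnatr_eq0 -lt0n. Qed.

Lemma vmeanB X Y : vmean (fun w => X w - Y w) = vmean X - vmean Y.
Proof. by rewrite /vmean sumrB scalerBr. Qed.

Lemma enorm_vmean_le X (c : R) :
  (forall w, enorm (X w) <= c) -> enorm (vmean X) <= c.
Proof.
move=> Xc; rewrite enormZ ger0_norm ?invr_ge0 // ler_pdivrMl ?ltr0n //.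
apply: le_trans (enorm_sum _ _) _.
apply: (@le_trans _ _ (\sum_(w : Omega) c)); first by apply: ler_sum => w _.
by rewrite sumr_const mulr_natl.
Qed.

(** Bias and variance: only the mean of [X] interacts with [a], and the
    variance is at most the second moment. *)
Lemma expectation_enorm_sqr_le X a (gamma V : R) :
  (forall w, enorm (X w) <= V) ->
  uniform_expectation (fun w => enorm (a - gamma *: X w) ^+ 2)
  <= enorm (a - gamma *: vmean X) ^+ 2 + gamma ^+ 2 * V ^+ 2.
Proof.
move=> XV.
apply: (@le_trans _ _ (uniform_expectation (fun w : Omega =>
  - (2 * gamma) * dotv a (X w) + (enorm a ^+ 2 + gamma ^+ 2 * V ^+ 2)))).
  apply: uniform_expectation_le => w.
  rewrite enorm_sqrB dotvZr enormZ exprMn real_normK ?num_real //.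
  have VX : enorm (X w) ^+ 2 <= V ^+ 2.
    by rewrite lerXn2r ?nnegrE ?enorm_ge0 // (le_trans (enorm_ge0 (X w))).
  by have := ler_wpM2l (sqr_ge0 gamma) VX; lra.
rewrite uniform_expectation_affine //.
have -> : uniform_expectation (fun w => dotv a (X w)) = dotv a (vmean X).
  by rewrite dotvZr dotv_sumr.
rewrite enorm_sqrB dotvZr.
have := sqr_ge0 (enorm (gamma *: vmean X)); lra.
Qed.

End VectorMean.

(** * The drift of one epoch *)

Section EpochPaths.
Variables (R : realType) (d n : nat) (f : 'I_n -> 'rV[R]_d -> R) (gamma : R).
Implicit Types (s : 'S_n) (x : 'rV[R]_d).

Lemma epoch_prefixS s x (k : 'I_n) :
  epoch_prefix f gamma s x k.+1
  = epoch_prefix f gamma s x k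
    - gamma *: grad (f (s k)) (epoch_prefix f gamma s x k).
Proof.
have kn : (k < size (enum 'I_n))%N by rewrite size_enum_ord.
have kn' : (k < size [seq s j | j <- enum 'I_n])%N by rewrite size_map.
rewrite /epoch_prefix (take_nth (s k) kn') (nth_map k _ _ kn) nth_ord_enum.
by rewrite -cats1 foldl_cat.
Qed.

Lemma epoch_prefixE s x (k : nat) : (k <= n)%N ->
  epoch_prefix f gamma s x k
  = x - gamma *: \sum_(j < n | (j < k)%N)
                    grad (f (s j)) (epoch_prefix f gamma s x j).
Proof.
elim: k => [_|k IH kn].
  by rewrite big_pred0_eq scaler0 subr0 /epoch_prefix take0.
rewrite (epoch_prefixS s x (Ordinal kn)) /= {1}IH 1?ltnW //.
rewrite [in RHS](bigD1 (Ordinal kn)) //= scalerDr opprD addrA [RHS]addrAC.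
congr (_ - _ *: _ - _); apply: eq_bigl => j.
by rewrite ltnS ltn_neqAle andbC -(inj_eq val_inj).
Qed.

End EpochPaths.

Section SparseEpoch.
Variables (R : realType) (d n m : nat) (e : 'I_n -> {set 'I_d}).
Variables (f : 'I_n -> 'rV[R]_d -> R) (L LH G gamma : R).
Hypotheses (L_ge0 : 0 <= L) (LH_ge0 : 0 <= LH) (gamma_ge0 : 0 <= gamma).
Hypothesis dgf : forall i x, differentiable (grad (f i)) x.
Hypotheses (sf : forall i, smooth L (f i)).
Hypotheses (hf : forall i, hessian_lipschitz LH (f i)).
Hypothesis grad_mask : forall i x v,
  grad (f i) (x + v *m coord_mask R (e i)) = grad (f i) (x + v).
Hypothesis grad_disjoint : forall i j x,
  (e i :&: e j = finset.set0)%SET -> grad (f j) x *m coord_mask R (e i) = 0.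
Hypothesis degree_le : forall i,
  (#|[set j : 'I_n | e i :&: e j != finset.set0]%SET| <= m)%N.
Implicit Types (s : 'S_n) (x v : 'rV[R]_d).

(** At most [m] of the terms survive the restriction to [e i]. The permutation
    [s] is there because the terms of an epoch are indexed by time. *)
Lemma enorm_sparse_sum i s (P : pred 'I_n) (u : 'I_n -> 'rV[R]_d) (c : R) :
  0 <= c -> (forall j, P j -> enorm (u j) <= c) ->
  (forall j, (e i :&: e (s j) = finset.set0)%SET ->
     u j *m coord_mask R (e i) = 0) ->
  enorm ((\sum_(j | P j) u j) *m coord_mask R (e i)) <= m%:R * c.
Proof.
move=> c0 uc u0; rewrite mulmx_suml; apply: le_trans (enorm_sum _ _) _.
pose Q j := (e i :&: e (s j) != finset.set0)%SET.
apply: (@le_trans _ _ (\sum_(j | P j && Q j) c)).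
  rewrite big_mkcondr; apply: ler_sum => j Pj; rewrite /Q.
  case: eqP => [/u0 ->|_]; first by rewrite enorm0.
  exact: le_trans (enorm_mask _ _) (uc j Pj).
apply: (@le_trans _ _ (\sum_(j | Q j) c)).
  rewrite [leRHS](bigID P) /= (eq_bigl _ _ (fun j => andbC _ _)).
  by rewrite lerDl sumr_ge0.
rewrite sumr_const -[c *+ _]mulr_natl ler_wpM2r // ler_nat.
apply: leq_trans (degree_le i); rewrite -(card_imset _ (@perm_inj _ s)).
apply: subset_leq_card; apply/fintype.subsetP => _ /imsetP[j Qj ->].
by rewrite finset.inE; move: Qj; rewrite unfold_in.
Qed.

Lemma grad_increment_le i x v :
  enorm (grad (f i) (x + v) - grad (f i) x)
  <= L * enorm (v *m coord_mask R (e i)).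
Proof.
rewrite -grad_mask; apply: le_trans (sf _ _ _) _.
by rewrite [x + _ - x]addrC addKr.
Qed.

(** The restriction builds sparsity in: [sparse_hessian_le] and
    [grad_taylor_le] then bound everything by the displacement inside [e i]. *)
Definition sparse_hessian x i : 'M[R]_d :=
  coord_mask R (e i) *m hessian (f i) x.

Lemma sparse_hessian_le x i v :
  enorm (v *m sparse_hessian x i) <= L * enorm (v *m coord_mask R (e i)).
Proof.
by rewrite mulmxA; apply: (enorm_mulmx_hessian (LH := LH)).
Qed.

Lemma grad_taylor_le i x v :
  enorm (grad (f i) (x + v) - grad (f i) x - v *m sparse_hessian x i)
  <= LH / 2 * enorm (v *m coord_mask R (e i)) ^+ 2.
Proof. by rewrite -grad_mask mulmxA; apply: taylor_grad. Qed.

Variable x : 'rV[R]_d.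
Local Notation iterate s k := (epoch_prefix f gamma s x k).
Hypothesis G_ge0 : 0 <= G.
Hypothesis grad_start_le : forall i, enorm (grad (f i) x) <= G.
Hypothesis grad_iterate_le : forall s (k : 'I_n) i,
  enorm (grad (f i) (iterate s k)) <= G.

(** Only the at most [m] components sharing a coordinate with component [i]
    can move the coordinates in [e i] during the epoch. *)
Lemma iterate_displacement_le s (k : 'I_n) i :
  enorm ((iterate s k - x) *m coord_mask R (e i)) <= gamma * (m%:R * G).
Proof.
rewrite epoch_prefixE 1?ltnW // addrAC subrr add0r mulNmx enormN -scalemxAl.
rewrite enormZ ger0_norm // ler_wpM2l //.
by apply: (enorm_sparse_sum (s := s)) => // j /grad_disjoint.
Qed.

Lemma iterate_increment_le s (k : 'I_n) i :
  enorm (grad (f i) (iterate s k) - grad (f i) x) <= L * (gamma * (m%:R * G)).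
Proof.
rewrite -{1}[iterate s k](subrK x) [_ + x]addrC.
apply: le_trans (grad_increment_le _ _ _) _.
by rewrite ler_wpM2l // iterate_displacement_le.
Qed.

(** What separates an epoch from a single gradient step of length [n * gamma]
    on the average; see [epochE]. *)
Definition drift s : 'rV[R]_d :=
  \sum_(k < n) (grad (f (s k)) (iterate s k) - grad (f (s k)) x).

(** The leading part of [drift]: all gradients and Hessians are frozen at the
    start of the epoch. *)
Definition frozen_drift s : 'rV[R]_d :=
  - (gamma *: \sum_(k < n) \sum_(j < n | (j < k)%N)
                 grad (f (s j)) x *m sparse_hessian x (s k)).

Lemma epochE s :
  epoch f gamma s x = x - gamma *: \sum_i grad (f i) x - gamma *: drift s.
Proof.
rewrite /epoch epoch_prefixE // -addrA -opprD -scalerDr; congr (_ - _ *: _).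
rewrite /drift sumrB [X in X + _](reindex_inj (@perm_inj _ s)) /= addrC subrK.
by apply: eq_bigl => j; rewrite ltn_ord.
Qed.

Lemma drift_le s : enorm (drift s) <= n%:R * (L * (gamma * (m%:R * G))).
Proof.
apply: le_trans (enorm_sum _ _) _.
apply: (@le_trans _ _ (\sum_(k < n) L * (gamma * (m%:R * G)))).
  by apply: ler_sum => k _; apply: iterate_increment_le.
by rewrite sumr_const card_ord -[_ *+ n]mulr_natl.
Qed.

(** Two errors, both quadratic in [gamma * m]: the Taylor remainder of the
    visited component, and the change since the start of the epoch of the at
    most [m] earlier gradients that it feels. *)
Lemma frozen_drift_le s :
  enorm (drift s - frozen_drift s)
  <= n%:R * ((gamma * m%:R) ^+ 2 * (LH / 2 * G ^+ 2 + L ^+ 2 * G)).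
Proof.
rewrite /drift /frozen_drift opprK scaler_sumr -big_split /=.
apply: le_trans (enorm_sum _ _) _.
pose c := (gamma * m%:R) ^+ 2 * (LH / 2 * G ^+ 2 + L ^+ 2 * G).
apply: (@le_trans _ _ (\sum_(k < n) c)); last first.
  by rewrite sumr_const card_ord -[_ *+ n]mulr_natl.
apply: ler_sum => k _; set i := s k; set A := sparse_hessian x i.
pose u j := grad (f (s j)) (iterate s j); pose w j := grad (f (s j)) x.
pose v := iterate s k - x.
have vE : v = - (gamma *: \sum_(j < n | (j < k)%N) u j).
  by rewrite /v epoch_prefixE 1?ltnW // addrAC subrr add0r.
rewrite -[iterate s k](subrK x) [_ + x]addrC -/v -mulmx_suml.
have -> : grad (f i) (x + v) - grad (f i) x
          + gamma *: ((\sum_(j < n | (j < k)%N) w j) *m A)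
  = (grad (f i) (x + v) - grad (f i) x - v *m A)
    - gamma *: ((\sum_(j < n | (j < k)%N) (u j - w j)) *m A).
  have -> : v *m A = - (gamma *: ((\sum_(j < n | (j < k)%N) u j) *m A)).
    by rewrite vE mulNmx scalemxAl.
  rewrite sumrB mulmxBl scalerBr opprK opprB.
  by rewrite [RHS]addrA [RHS]addrAC [in RHS]addrK.
apply: le_trans (enormB _ _) _.
rewrite enormZ (ger0_norm gamma_ge0).
have disp : enorm (v *m coord_mask R (e i)) <= gamma * (m%:R * G).
  exact: iterate_displacement_le.
have t1 : enorm (grad (f i) (x + v) - grad (f i) x - v *m A)
          <= LH / 2 * (gamma * (m%:R * G)) ^+ 2.
  apply: le_trans (grad_taylor_le _ _ _) _.
  by rewrite ler_wpM2l ?divr_ge0 // lerXn2r ?nnegrE ?enorm_ge0 ?mulr_ge0.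
have t2 : enorm ((\sum_(j < n | (j < k)%N) (u j - w j)) *m A)
          <= L * (m%:R * (L * (gamma * (m%:R * G)))).
  apply: le_trans (sparse_hessian_le _ _ _) _; rewrite ler_wpM2l //.
  apply: (enorm_sparse_sum (s := s)) => [|j _|j ij]; first by rewrite !mulr_ge0.
    exact: iterate_increment_le.
  by rewrite mulmxBl !grad_disjoint // subrr.
apply: le_trans (lerD t1 (ler_wpM2l gamma_ge0 t2)) _.
by rewrite le_eqVlt; apply/orP; left; apply/eqP; rewrite /c; ring.
Qed.

(** A permutation and its reversal together visit every ordered pair of
    distinct components exactly once in the order (earlier, later), so the
    average over all permutations needs no probability computation. *)
Lemma vmean_frozen_drift :
  vmean frozen_drift
  = - ((gamma / 2) *: \sum_i (\sum_(j | j != i) grad (f j) x)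
                              *m sparse_hessian x i).
Proof.
pose B i j := grad (f j) x *m sparse_hessian x i.
pose Q s := \sum_(k < n) \sum_(j < n | (j < k)%N) B (s k) (s j).
pose S : 'rV[R]_d := \sum_i \sum_(j | j != i) B i j.
pose rho : 'S_n := perm (@rev_ord_inj n).
have Q_rev s : Q (rho * s)%g
    = \sum_(k < n) \sum_(j < n | (k < j)%N) B (s k) (s j).
  rewrite [LHS](reindex_inj (@rev_ord_inj n)).
  apply: eq_bigr => k _.
  rewrite [LHS](reindex_inj (@rev_ord_inj n)).
  apply: eq_big => [j|j _].
    by rewrite ltn_sub2lE ?ltnS.
  by rewrite !permM !permE !rev_ordK.
have S_perm s : S = \sum_(k < n) \sum_(j < n | j != k) B (s k) (s j).
  rewrite [LHS](reindex_inj (@perm_inj _ s)); apply: eq_bigr => k _.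
  rewrite [LHS](reindex_inj (@perm_inj _ s)); apply: eq_bigl => j.
  by rewrite (inj_eq perm_inj).
have pair s : frozen_drift s + frozen_drift (rho * s)%g = - (gamma *: S).
  rewrite -[frozen_drift s]/(- (gamma *: Q s)).
  rewrite -[frozen_drift _]/(- (gamma *: Q (rho * s)%g)).
  rewrite -opprD -scalerDr Q_rev (S_perm s) -big_split /=.
  congr (- (_ *: _)); apply: eq_bigr => k _.
  rewrite [RHS](bigID (fun j : 'I_n => (j < k)%N)) /=.
  congr (_ + _); apply: eq_bigl => j.
    by rewrite -(inj_eq val_inj) /=; case: ltngtP.
  by rewrite -(inj_eq val_inj) /=; case: ltngtP.
have tot : (\sum_s frozen_drift s) *+ 2 = - (gamma *: S) *+ #|{: 'S_n}|.
  rewrite mulr2n [X in _ + X](reindex_inj (mulgI rho)) -big_split /=.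
  by rewrite (eq_bigr _ (fun s _ => pair s)) sumr_const.
have card0 : (#|{: 'S_n}|%:R : R) != 0.
  by rewrite pnatr_eq0 -lt0n; apply/card_gt0P; exists 1%g.
have -> : \sum_i (\sum_(j | j != i) grad (f j) x) *m sparse_hessian x i = S.
  by apply: eq_bigr => i _; rewrite mulmx_suml.
have sumE : \sum_s frozen_drift s = #|{: 'S_n}|%:R *: - ((gamma / 2) *: S).
  apply: (@scalerI _ _ (2 : R)); first by rewrite pnatr_eq0.
  rewrite [LHS]scaler_nat tot -scaler_nat !scalerN !scalerA; congr (- (_ *: _)).
  by field.
by rewrite /vmean sumE scalerA mulVf // scale1r.
Qed.

(** The average displacement of an epoch is that of Heun's method with time
    step [n * gamma], up to the displayed error: the diagonal pairs missing
    from [vmean_frozen_drift] give its first term, freezing the second, and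
    replacing Hessian-vector products by gradient differences the third. *)
Lemma vmean_drift_heun (h := n%:R * gamma)
    (gradF := n%:R^-1 *: \sum_i grad (f i) x) : (0 < n)%N ->
  enorm (vmean drift
         - 2^-1 *: \sum_i (grad (f i) (x - h *: gradF) - grad (f i) x))
  <= gamma / 2 * (n%:R * (L * G))
     + n%:R * ((gamma * m%:R) ^+ 2 * (LH / 2 * G ^+ 2 + L ^+ 2 * G))
     + n%:R / 2 * (LH / 2 * (h * enorm gradF) ^+ 2).
Proof.
move=> n0.
have card_gt0 : (0 < #|{: 'S_n}|)%N by apply/card_gt0P; exists 1%g.
have h0 : 0 <= h by rewrite mulr_ge0.
have hE : h = gamma * n%:R by rewrite mulrC.
have gradFE : n%:R *: gradF = \sum_i grad (f i) x.
  by rewrite scalerA mulfV ?scale1r // pnatr_eq0 -lt0n.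
clearbody h gradF.
pose A i := sparse_hessian x i.
pose err i :=
  grad (f i) (x - h *: gradF) - grad (f i) x - (- (h *: gradF)) *m A i.
have split_mean : vmean frozen_drift
    - 2^-1 *: \sum_i (grad (f i) (x - h *: gradF) - grad (f i) x)
  = (gamma / 2) *: \sum_i grad (f i) x *m A i - 2^-1 *: \sum_i err i.
  rewrite vmean_frozen_drift /err [X in _ = _ - _ *: X]sumrB.
  have -> : \sum_i (\sum_(j | j != i) grad (f j) x) *m sparse_hessian x i
    = \sum_i (n%:R *: gradF) *m A i - \sum_i grad (f i) x *m A i.
    rewrite -sumrB; apply: eq_bigr => i _; rewrite -mulmxBl; congr (_ *m _).
    by rewrite gradFE [in RHS](bigD1 i) //= [in RHS]addrC addrK.
  have -> : \sum_i (- (h *: gradF)) *m A i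
          = - (gamma *: \sum_i (n%:R *: gradF) *m A i).
    rewrite scaler_sumr -sumrN; apply: eq_bigr => i _.
    by rewrite mulNmx !scalemxAl scalerA hE.
  rewrite scalerBr opprB opprK scalerDr scalerA [2^-1 * gamma]mulrC opprD.
  by rewrite addrA addrAC.
have -> : vmean drift
    - 2^-1 *: \sum_i (grad (f i) (x - h *: gradF) - grad (f i) x)
  = ((gamma / 2) *: \sum_i grad (f i) x *m A i
     + vmean (fun s => drift s - frozen_drift s)) - 2^-1 *: \sum_i err i.
  by rewrite addrAC -split_mean vmeanB addrC addrA addrNK.
apply: le_trans (enormB _ _) _; apply: lerD.
  apply: le_trans (enormD _ _) _; apply: lerD.
    rewrite enormZ ger0_norm ?divr_ge0 // ler_wpM2l ?divr_ge0 //.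
    apply: le_trans (enorm_sum _ _) _.
    apply: (@le_trans _ _ (\sum_(i < n) L * G)); last first.
      by rewrite sumr_const card_ord -[_ *+ n]mulr_natl.
    apply: ler_sum => i _; apply: le_trans (sparse_hessian_le _ _ _) _.
    by rewrite ler_wpM2l // (le_trans (enorm_mask _ _)).
  by apply: enorm_vmean_le => // s; apply: frozen_drift_le.
rewrite enormZ ger0_norm ?invr_ge0 //.
rewrite [n%:R / 2]mulrC -[_ * n%:R * _]mulrA ler_wpM2l ?invr_ge0 //.
apply: le_trans (enorm_sum _ _) _.
apply: (@le_trans _ _ (\sum_(i < n) LH / 2 * (h * enorm gradF) ^+ 2));
  last first.
  by rewrite sumr_const card_ord -[_ *+ n]mulr_natl.
apply: ler_sum => i _; apply: le_trans (grad_taylor_le _ _ _) _.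
rewrite ler_wpM2l ?divr_ge0 // lerXn2r ?nnegrE ?enorm_ge0 //.
  by rewrite mulr_ge0 ?enorm_ge0.
by apply: le_trans (enorm_mask _ _) _; rewrite enormN enormZ ger0_norm.
Qed.

End SparseEpoch.

(** * Contraction in expectation *)

Section ExpectedContraction.
Variables (R : realType) (S : finType) (V : Type).
Variables (step : V -> S -> V) (phi : V -> R) (safe : S -> V -> Prop).
Variables (r c err : R).
Hypotheses (S_gt0 : (0 < #|S|)%N) (r_ge0 : 0 <= r).
Hypothesis err_le : err <= (1 - r) * c.
Hypothesis step_le : forall x, (forall s, safe s x) ->
  uniform_expectation (fun s => phi (step x s)) <= r * phi x + err.

(** Condition on the first sample. By [err_le], [c] is a fixed point of the
    recursion [v |-> r * v + err] or lies above it. Safety is asked only of the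
    states that are actually reached. *)
Lemma uniform_expectation_foldl_le (k : nat) x :
  (forall (w : k.-tuple S) (t : 'I_k),
     safe (tnth w t) (foldl step x (take t w))) ->
  uniform_expectation (fun w : k.-tuple S => phi (foldl step x w))
  <= r ^+ k * phi x + (1 - r ^+ k) * c.
Proof.
elim: k x => [|k IH] x safe_x.
  apply: uniform_expectation_le_cst => [|w]; first by rewrite card_tuple.
  by rewrite tuple0 /= expr0 mul1r subrr mul0r addr0.
rewrite uniform_expectation_tupleS.
apply: (@le_trans _ _ (uniform_expectation (fun s =>
          r ^+ k * phi (step x s) + (1 - r ^+ k) * c))).
  apply: uniform_expectation_le => s; apply: (IH (step x s)) => w t.
  have := safe_x [tuple of s :: w] (lift ord0 t).
  by rewrite tnthS.
rewrite uniform_expectation_affine //.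
have xP s : safe s x.
  by have := safe_x [tuple of s :: nseq k s] ord0; rewrite tnth0.
have rk : 0 <= r ^+ k by rewrite exprn_ge0.
have := ler_wpM2l rk (step_le xP); have := ler_wpM2l rk err_le.
rewrite exprS; lra.
Qed.

End ExpectedContraction.

(** Convexity of the square, with weights [1 - z / 2] and [z / 2]. *)
Lemma sqr_contract_le (R : realFieldType) (z W c : R) : 0 < z -> z <= 2 ->
  ((1 - z / 2) * W + c) ^+ 2 <= (1 - z / 2) * W ^+ 2 + 2 / z * c ^+ 2.
Proof.
move=> z0 z2; rewrite -subr_ge0.
have -> : (1 - z / 2) * W ^+ 2 + 2 / z * c ^+ 2 - ((1 - z / 2) * W + c) ^+ 2
        = (1 - z / 2) * (2 / z) * (z / 2 * W - c) ^+ 2.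
  by field; rewrite gt_eqF.
have z_ge0 : 0 <= 1 - z / 2 by lra.
by rewrite mulr_ge0 ?sqr_ge0 // mulr_ge0 // divr_ge0 // ltW.
Qed.

(** The error of Heun's step as an approximation of the mean drift is quadratic
    in the gradient [p]; bounding one factor by [G] and the other by [L * W]
    makes it a small multiple of the contraction. *)
Lemma curvature_term_le (R : realFieldType) (mu L LH G gamma n p W : R) :
  0 < mu -> 0 <= L -> 0 <= LH -> 0 <= gamma -> 0 <= n -> 0 <= p ->
  p <= G -> p <= L * W -> 0 <= W ->
  n * gamma * L <= 2 / 3 -> n * gamma * (LH * G) <= mu / 12 ->
  gamma * (n / 2 * (LH / 2 * (n * gamma * p) ^+ 2)) <= n * gamma * mu / 6 * W.
Proof.
move=> mu0 L0 LH0 g0 n0 p0 pG pL W0 hL hLH.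
have -> : gamma * (n / 2 * (LH / 2 * (n * gamma * p) ^+ 2))
    = (n * gamma / 4) * ((n * gamma * (LH * p)) * (n * gamma * p)) by field.
have h0 : 0 <= n * gamma by rewrite mulr_ge0.
move: (n * gamma) h0 hL hLH => h h0 hL hLH.
have a1 : h * (LH * p) <= mu / 12.
  by apply: le_trans hLH; rewrite ler_wpM2l // ler_wpM2l.
have a2 : h * p <= 2 / 3 * W.
  by apply: le_trans (ler_wpM2l h0 pL) _; rewrite mulrA ler_wpM2r.
have a3 : (h * (LH * p)) * (h * p) <= mu / 12 * (2 / 3 * W).
  by rewrite ler_pM ?mulr_ge0.
apply: le_trans (ler_wpM2l _ a3) _; first by rewrite divr_ge0.
have := mulr_ge0 (mulr_ge0 h0 (ltW mu0)) W0; lra.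
Qed.

Section EpochContraction.
Variables (R : realType) (mu L LH D G gamma : R) (d n m : nat).
Variables (e : 'I_n -> {set 'I_d}) (g : forall i : 'I_n, 'rV[R]_#|e i| -> R).
Variable xs : 'rV[R]_d.
Let f i := on_coords (@g i).
Let F := finite_sum_avg f.
Let h := n%:R * gamma.
Hypotheses (mu_gt0 : 0 < mu) (G_ge0 : 0 <= G) (gamma_gt0 : 0 < gamma).
Hypotheses (n_gt0 : (0 < n)%N) (d_gt0 : (0 < d)%N).
Hypothesis tdf : forall i, twice_differentiable (f i).
Hypotheses (sf : forall i, smooth L (f i)).
Hypotheses (hf : forall i, hessian_lipschitz LH (f i)).
Hypotheses (scF : strongly_convex mu F) (xs_min : forall x, F xs <= F x).
Hypothesis grad_le : forall i x,
  enorm (x - xs) <= D -> enorm (grad (f i) x) <= G.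
Hypothesis degree_le : forall i,
  (#|[set j : 'I_n | e i :&: e j != finset.set0]%SET| <= m)%N.
Hypotheses (hL_le : h * L <= 2 / 3) (hLH_le : h * (LH * G) <= mu / 12).

Definition bias_bound : R :=
  gamma / 2 * (n%:R * (L * G))
  + n%:R * ((gamma * m%:R) ^+ 2 * (LH / 2 * G ^+ 2 + L ^+ 2 * G)).

Definition drift_bound : R := n%:R * (L * (gamma * (m%:R * G))).

(** The mean of an epoch is a Heun step plus a small bias [b]; the Heun step
    contracts, and its slack absorbs the part of [b] that is proportional to
    the distance to [xs]. What remains is [bias_bound], entering squared and
    divided by the rate [h * mu], and the variance, bounded by
    [drift_bound ^+ 2]. *)
Lemma epoch_contraction x :
  (forall s (k : 'I_n), enorm (epoch_prefix f gamma s x k - xs) <= D) ->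
  uniform_expectation (fun s : 'S_n => enorm (epoch f gamma s x - xs) ^+ 2)
  <= (1 - h * mu / 2) * enorm (x - xs) ^+ 2
     + (2 / (h * mu) * (gamma * bias_bound) ^+ 2
        + gamma ^+ 2 * drift_bound ^+ 2).
Proof.
move=> xD.
have df i z : differentiable (f i) z by have [] := tdf i.
have dgf i z : differentiable (grad (f i)) z by have [] := tdf i.
have dF z : differentiable F z by apply: differentiable_finite_sum_avg.
have sF : smooth L F by apply: smooth_finite_sum_avg.
have L_gt0 : 0 < L.
  exact: lt_le_trans mu_gt0 (strong_convexity_le_smoothness sF scF d_gt0).
have mu_le_L : mu <= L := strong_convexity_le_smoothness sF scF d_gt0.
have LH_ge0 : 0 <= LH := hessian_lipschitz_ge0 d_gt0 (hf (Ordinal n_gt0)).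
have h_gt0 : 0 < h by rewrite mulr_gt0 ?ltr0n.
have z_le : h * mu <= 2 / 3 by rewrite (le_trans _ hL_le) // ler_pM2l.
have iter_le s (k : 'I_n) i :
    enorm (grad (f i) (epoch_prefix f gamma s x k)) <= G.
  exact/grad_le/xD.
have start_le i : enorm (grad (f i) x) <= G.
  by have := iter_le 1%g (Ordinal n_gt0) i; rewrite /epoch_prefix take0.
have gmask i z v :
    grad (f i) (z + v *m coord_mask R (e i)) = grad (f i) (z + v).
  exact: grad_on_coords_mask.
have gdisj i j z : (e i :&: e j = finset.set0)%SET ->
    grad (f j) z *m coord_mask R (e i) = 0.
  exact: grad_on_coords_disjoint.
have gradFE z : \sum_i grad (f i) z = n%:R *: grad F z.
  by rewrite grad_finite_sum_avg // scalerA mulfV ?scale1r // pnatr_eq0 -lt0n.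
pose dr := drift f gamma x.
pose y := x - h *: grad F x.
pose b := vmean dr - 2^-1 *: \sum_i (grad (f i) y - grad (f i) x).
have b_le : enorm b
    <= bias_bound + n%:R / 2 * (LH / 2 * (h * enorm (grad F x)) ^+ 2).
  have := vmean_drift_heun (ltW L_gt0) LH_ge0 (ltW gamma_gt0) dgf sf hf gmask
            gdisj degree_le G_ge0 start_le iter_le n_gt0.
  by rewrite -grad_finite_sum_avg.
have epochB s :
    epoch f gamma s x - xs = (x - xs - h *: grad F x) - gamma *: dr s.
  rewrite epochE gradFE scalerA [gamma * _]mulrC -/h.
  by rewrite addrAC; congr (_ - _); rewrite addrAC.
have dr_le s : enorm (dr s) <= drift_bound.
  exact: (drift_le (ltW L_gt0) (ltW gamma_gt0) sf gmask gdisj degree_le).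
have card_gt0 : (0 < #|{: 'S_n}|)%N by apply/card_gt0P; exists 1%g.
have mean_le := expectation_enorm_sqr_le card_gt0
  (x - xs - h *: grad F x) gamma dr_le.
rewrite (_ : (fun s => _) = fun s : 'S_n =>
  enorm (x - xs - h *: grad F x - gamma *: dr s) ^+ 2); last first.
  by apply/funext => s; rewrite epochB.
apply: le_trans mean_le _; rewrite addrA lerD2r.
have -> : x - xs - h *: grad F x - gamma *: vmean dr
  = (x - (h / 2) *: (grad F x + grad F y) - xs) - gamma *: b.
  rewrite /b sumrB !gradFE; move: (grad F x) (grad F y) (vmean dr) => p q v.
  by apply/rowP => j; rewrite !mxE /h; field.
have heun :=
  heun_step_contract dF sF mu_gt0 scF xs_min L_gt0 x (ltW h_gt0) hL_le.
have gradF_le_G : enorm (grad F x) <= G.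
  rewrite grad_finite_sum_avg // enormZ ger0_norm ?invr_ge0 //.
  rewrite ler_pdivrMl ?ltr0n //; apply: le_trans (enorm_sum _ _) _.
  apply: (@le_trans _ _ (\sum_(i < n) G)); first exact: ler_sum.
  by rewrite sumr_const card_ord -[_ *+ n]mulr_natl.
have gradF_le_L : enorm (grad F x) <= L * enorm (x - xs).
  by have := sF x xs; rewrite (grad_minimizer dF sF xs_min L_gt0) subr0.
have curvature_le : gamma * (n%:R / 2 * (LH / 2 * (h * enorm (grad F x)) ^+ 2))
    <= h * mu / 6 * enorm (x - xs).
  exact: (curvature_term_le mu_gt0 (ltW L_gt0) LH_ge0 (ltW gamma_gt0)
    (ler0n _ n) (enorm_ge0 _) gradF_le_G gradF_le_L (enorm_ge0 _) hL_le hLH_le).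
have main : enorm (x - (h / 2) *: (grad F x + grad F y) - xs - gamma *: b)
    <= (1 - h * mu / 2) * enorm (x - xs) + gamma * bias_bound.
  apply: le_trans (enormB _ _) _; rewrite enormZ gtr0_norm //.
  apply: le_trans (lerD heun (ler_wpM2l (ltW gamma_gt0) b_le)) _.
  rewrite [gamma * (_ + _)]mulrDr; move: curvature_le.
  move: (enorm (x - xs)) (gamma * bias_bound) (h * mu) (gamma * (_ / _ * _)).
  by move=> W B z c {heun b_le dr_le}; lra.
have z_gt0 : 0 < h * mu by rewrite mulr_gt0.
apply: le_trans (sqr_contract_le (enorm (x - xs)) (gamma * bias_bound) z_gt0 _).
  by rewrite ler_sqr ?nnegrE ?enorm_ge0 // (le_trans (enorm_ge0 _) main).
by apply: le_trans z_le _; lra.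
Qed.

End EpochContraction.

(** * The rate *)

(** The fixed point of the epoch recursion. Dividing the squared bias by
    [(h * mu) ^+ 2] with [h = n * gamma] leaves [gamma ^+ 2] from the diagonal
    pairs; the remaining terms carry [(gamma * m) ^+ 4] or
    [gamma ^+ 3 * m ^+ 2 * n], and [m <= n], [h * mu <= 1] merge them. *)
Lemma fixed_point_le (R : realFieldType) (mu L G K gamma n m : R) :
  0 < mu -> 0 < gamma -> 0 < n -> 0 <= m -> m <= n -> n * gamma * mu <= 1 ->
  2 / (n * gamma * mu) *
    (2 / (n * gamma * mu)
       * (gamma * (gamma / 2 * (n * (L * G)) + n * ((gamma * m) ^+ 2 * K))) ^+ 2
     + gamma ^+ 2 * (n * (L * (gamma * (m * G)))) ^+ 2)
  <= 2 * (L * G) ^+ 2 / mu ^+ 2 * gamma ^+ 2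
     + (8 * K ^+ 2 / mu ^+ 3 + 2 * (L * G) ^+ 2 / mu)
       * (gamma ^+ 3 * (m ^+ 2 * n)).
Proof.
move=> mu0 g0 n0 m0 mn z1.
pose a := L * G; pose b := gamma * m ^+ 2 * K.
have -> : 2 / (n * gamma * mu) *
    (2 / (n * gamma * mu)
       * (gamma * (gamma / 2 * (n * (L * G)) + n * ((gamma * m) ^+ 2 * K))) ^+ 2
     + gamma ^+ 2 * (n * (L * (gamma * (m * G)))) ^+ 2)
  = 4 / mu ^+ 2 * gamma ^+ 2 * (a / 2 + b) ^+ 2
    + 2 * a ^+ 2 / mu * (gamma ^+ 3 * (m ^+ 2 * n)).
  by rewrite /a /b; field; rewrite !gt_eqF.
have sq : (a / 2 + b) ^+ 2 <= a ^+ 2 / 2 + 2 * b ^+ 2.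
  by have := sqr_ge0 (a / 2 - b); lra.
have coef : 0 <= 4 / mu ^+ 2 * gamma ^+ 2.
  by rewrite mulr_ge0 ?divr_ge0 ?sqr_ge0.
have merge : gamma * m ^+ 2 <= n / mu.
  rewrite ler_pdivlMr //; apply: (@le_trans _ _ (n * (n * gamma * mu))).
    have -> : gamma * m ^+ 2 * mu = gamma * mu * (m * m) by ring.
    have -> : n * (n * gamma * mu) = gamma * mu * (n * n) by ring.
    by rewrite ler_wpM2l ?ler_pM // mulr_ge0 // ltW.
  by rewrite -[leRHS]mulr1 ler_wpM2l // ltW.
have b2 : b ^+ 2 <= K ^+ 2 / mu * (gamma * (m ^+ 2 * n)).
  have -> : b ^+ 2 = K ^+ 2 * (gamma * m ^+ 2) * (gamma * m ^+ 2).
    by rewrite /b; ring.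
  have -> : K ^+ 2 / mu * (gamma * (m ^+ 2 * n))
          = K ^+ 2 * (gamma * m ^+ 2) * (n / mu) by field; rewrite gt_eqF.
  by rewrite ler_wpM2l // mulr_ge0 ?sqr_ge0 // mulr_ge0 ?sqr_ge0 // ltW.
apply: (@le_trans _ _ (4 / mu ^+ 2 * gamma ^+ 2
    * (a ^+ 2 / 2 + 2 * (K ^+ 2 / mu * (gamma * (m ^+ 2 * n))))
    + 2 * a ^+ 2 / mu * (gamma ^+ 3 * (m ^+ 2 * n)))).
  rewrite lerD2r ler_wpM2l //; apply: le_trans sq _.
  by rewrite lerD2l ler_wpM2l.
rewrite le_eqVlt; apply/orP; left; apply/eqP.
by rewrite /a; field; rewrite gt_eqF.
Qed.

(** Powers of the step size in terms of the number of iterations [T], with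
    [lambda] for its logarithm. *)
Lemma step_size_rate (R : realFieldType) (mu lambda T C1 C2 D2 rn : R) :
  0 < mu -> 0 <= lambda -> 0 < T -> 0 <= C1 -> 0 <= C2 -> 0 <= D2 -> 0 <= rn ->
  D2 / T ^+ 2 + (C1 * (8 * lambda / (T * mu)) ^+ 2
                 + C2 * ((8 * lambda / (T * mu)) ^+ 3 * rn))
  <= (D2 + 64 * C1 / mu ^+ 2 + 512 * C2 / mu ^+ 3) * (1 + lambda) ^+ 3
     * (1 / T ^+ 2 + rn / T ^+ 3).
Proof.
move=> mu0 l0 T0 C10 C20 D20 rn0.
have muI : 0 <= mu^-1 by rewrite invr_ge0 ltW.
have TI : 0 <= T^-1 by rewrite invr_ge0 ltW.
pose P2 := 64 * C1 / mu ^+ 2; pose P3 := 512 * C2 / mu ^+ 3.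
have P20 : 0 <= P2.
  apply: divr_ge0; last exact/exprn_ge0/ltW.
  by apply: mulr_ge0; first exact: ler0n.
have P30 : 0 <= P3.
  apply: divr_ge0; last exact/exprn_ge0/ltW.
  by apply: mulr_ge0; first exact: ler0n.
have -> : D2 / T ^+ 2 + (C1 * (8 * lambda / (T * mu)) ^+ 2
                 + C2 * ((8 * lambda / (T * mu)) ^+ 3 * rn))
  = (D2 * 1 + P2 * lambda ^+ 2) * (1 / T ^+ 2)
    + P3 * lambda ^+ 3 * (rn / T ^+ 3).
  by rewrite /P2 /P3; field; rewrite !gt_eqF.
set u := 1 / T ^+ 2; set v := rn / T ^+ 3; set w := (1 + lambda) ^+ 3.
have u0 : 0 <= u by rewrite divr_ge0 // exprn_ge0 // ltW.
have v0 : 0 <= v by rewrite divr_ge0 // exprn_ge0 // ltW.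
have l2 : 0 <= lambda ^+ 2 by rewrite exprn_ge0.
have l3 : 0 <= lambda ^+ 3 by rewrite exprn_ge0.
have wE : w = 1 + 3 * lambda + 3 * lambda ^+ 2 + lambda ^+ 3.
  by rewrite /w; ring.
have w1 : 1 <= w by rewrite wE; lra.
have w2 : lambda ^+ 2 <= w by rewrite wE; lra.
have w3 : lambda ^+ 3 <= w by rewrite wE; lra.
have -> : (D2 + P2 + P3) * w * (u + v)
  = (D2 * w + P2 * w) * u + P3 * w * v + (P3 * w * u + (D2 + P2) * w * v).
  by ring.
have w0 : 0 <= w by apply: le_trans w1.
rewrite -[leLHS]addr0 lerD //.
  by rewrite lerD // ler_wpM2r // ?lerD // ler_wpM2l.
have P30w : 0 <= P3 * w by apply: mulr_ge0.
have D2w : 0 <= (D2 + P2) * w by apply: mulr_ge0; rewrite ?addr_ge0.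
by apply: addr_ge0; apply: mulr_ge0.
Qed.

Theorem theorem4 (R : realType) (mu L LH D G : R)
    (mu_gt0 : 0 < mu) (D_gt0 : 0 < D) (G_gt0 : 0 < G) :
  exists C0 q : R, 0 < C0 /\ 0 < q /\
  forall (d n l T : nat) (e : 'I_n -> {set 'I_d})
      (g : forall i : 'I_n, 'rV[R]_#|e i| -> R) (xs x0 : 'rV[R]_d),
    let f := fun i : 'I_n => on_coords (g i) in
    let F := finite_sum_avg f in
    let rho := sparsity R e in
    let C := Num.max (32 / mu ^+ 2 * (LH * L * D + 3 * LH * G))
                     (12 * (1 + L / mu)) in
    let gamma := 8 * ln T%:R / (T%:R * mu) in
    (forall i, e i != finset.set0) ->
    (forall i, convex_function setT (f i)) ->
    (forall i, twice_differentiable (f i)) ->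
    (forall i, smooth L (f i)) ->
    (forall i, hessian_lipschitz LH (f i)) ->
    strongly_convex mu F ->
    unique_minimizer F xs ->
    (forall (sigma : l.-tuple 'S_n) (t : 'I_l) (k : nat), (k <= n)%N ->
       enorm (shuffle_iterate f gamma x0 sigma t k - xs) <= D) ->
    (forall i (x : 'rV[R]_d), enorm (x - xs) <= D -> enorm (grad (f i) x) <= G) ->
    (0 < l)%N -> (2 <= T)%N -> T = (l * n)%N ->
    C * n%:R < T%:R / ln T%:R ->
    uniform_expectation
      (fun sigma : l.-tuple 'S_n =>
         enorm (shuffle_output f gamma x0 sigma - xs) ^+ 2)
    <= C0 * (1 + ln T%:R) `^ q
       * (1 / T%:R ^+ 2 + rho ^+ 2 * n%:R ^+ 3 / T%:R ^+ 3).
Proof.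
pose K := LH / 2 * G ^+ 2 + L ^+ 2 * G.
pose C1 := 2 * (L * G) ^+ 2 / mu ^+ 2.
pose C2 := 8 * K ^+ 2 / mu ^+ 3 + 2 * (L * G) ^+ 2 / mu.
have sq2_ge0 (k a : R) : 0 <= k -> 0 <= k * a ^+ 2.
  by move=> k0; apply: mulr_ge0 k0 (sqr_ge0 a).
have C1_ge0 : 0 <= C1 by apply: divr_ge0 (sq2_ge0 _ _ _) (sqr_ge0 _).
have C2_ge0 : 0 <= C2.
  by apply: addr_ge0; apply: divr_ge0; rewrite ?sq2_ge0 ?exprn_ge0 ?ltW.
exists (D ^+ 2 + 64 * C1 / mu ^+ 2 + 512 * C2 / mu ^+ 3), 3.
split.
  have c1 : 0 <= 64 * C1 / mu ^+ 2.
    by apply: divr_ge0 (sqr_ge0 _); apply: mulr_ge0 C1_ge0; apply: ler0n.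
  have c2 : 0 <= 512 * C2 / mu ^+ 3.
    apply: divr_ge0; last by rewrite exprn_ge0 // ltW.
    by apply: mulr_ge0 C2_ge0; apply: ler0n.
  by rewrite -addrA; apply: ltr_pwDl (addr_ge0 c1 c2); rewrite exprn_gt0.
split=> // d n l T e g xs x0 f F rho C gamma e0 _ tdf sf hf scF [xs_min _]
  iterate_le grad_le l_gt0 T_ge2 TE C_lt.
have n_gt0 : (0 < n)%N.
  move: T_ge2; rewrite TE; apply: contraTT.
  by rewrite -eqn0Ngt => /eqP ->; rewrite muln0.
have d_gt0 : (0 < d)%N.
  have /set0Pn[j _] := e0 (Ordinal n_gt0).
  exact: leq_ltn_trans (leq0n j) (ltn_ord j).
have T_gt0 : 0 < T%:R :> R by rewrite ltr0n ltnW.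
have lnT_gt0 : 0 < ln T%:R :> R by rewrite ln_gt0 // ltr1n.
have gamma_gt0 : 0 < gamma by rewrite divr_gt0 ?mulr_gt0.
have dF z : differentiable F z.
  by apply: differentiable_finite_sum_avg => i {}z; have [] := tdf i.
have sF : smooth L F.
  by apply: smooth_finite_sum_avg => // i z; have [] := tdf i.
have mu_le_L : mu <= L := strong_convexity_le_smoothness sF scF d_gt0.
have L_ge0 : 0 <= L by apply: le_trans mu_le_L; apply: ltW.
have LH_ge0 : 0 <= LH := hessian_lipschitz_ge0 d_gt0 (hf (Ordinal n_gt0)).
pose h := n%:R * gamma.
have h_gt0 : 0 < h by rewrite mulr_gt0 ?ltr0n.
(* The condition on [T] says that [h * mu] is at most [8 / C]; the two members
   of the maximum give the two smallness conditions on [h]. *)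
have hC : h * mu * C <= 8.
  have -> : h * mu * C = C * n%:R * (8 * ln T%:R / T%:R).
    by rewrite /h /gamma; field; rewrite !gt_eqF.
  apply: le_trans (ler_wpM2r _ (ltW C_lt)) _.
    by rewrite divr_ge0 ?mulr_ge0 // ltW.
  by rewrite le_eqVlt; apply/orP; left; apply/eqP; field; rewrite !gt_eqF.
have hmu_gt0 : 0 < h * mu by rewrite mulr_gt0.
have hL_le : h * L <= 2 / 3.
  have : h * mu * (12 * (1 + L / mu)) <= 8.
    by apply: le_trans hC; rewrite ler_pM2l // le_max lexx orbT.
  have -> : h * mu * (12 * (1 + L / mu)) = 12 * (h * mu) + 12 * (h * L).
    by field; rewrite gt_eqF.
  lra.
have hLH_le : h * (LH * G) <= mu / 12.
  have : h * mu * (32 / mu ^+ 2 * (LH * L * D + 3 * LH * G)) <= 8.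
    by apply: le_trans hC; rewrite ler_pM2l // le_max lexx.
  have -> : h * mu * (32 / mu ^+ 2 * (LH * L * D + 3 * LH * G))
          = (32 * (h * (LH * L * D)) + 96 * (h * (LH * G))) / mu.
    by field; rewrite gt_eqF.
  rewrite ler_pdivrMr //.
  have : 0 <= h * (LH * L * D).
    exact: mulr_ge0 (ltW h_gt0) (mulr_ge0 (mulr_ge0 LH_ge0 L_ge0) (ltW D_gt0)).
  lra.
have z_le1 : h * mu <= 1.
  by apply: le_trans (ler_wpM2l (ltW h_gt0) mu_le_L) _; lra.
pose m := (\max_(i < n) #|[set j : 'I_n | e i :&: e j != finset.set0]%SET|)%N.
have degree_le i : (#|[set j : 'I_n | e i :&: e j != finset.set0]%SET| <= m)%N.
  exact: (leq_bigmax i).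
have m_le_n : (m <= n)%N.
  apply/bigmax_leqP => i _; rewrite -[X in (_ <= X)%N](card_ord n).
  exact: max_card.
pose step := fun x (s : 'S_n) => epoch f gamma s x.
pose phi := fun x => enorm (x - xs) ^+ 2.
pose safe := fun (s : 'S_n) x =>
  forall k : 'I_n, enorm (epoch_prefix f gamma s x k - xs) <= D.
pose err := 2 / (h * mu) * (gamma * bias_bound L LH G gamma n m) ^+ 2
            + gamma ^+ 2 * drift_bound L G gamma n m ^+ 2.
pose c := 2 / (h * mu) * err.
have card_gt0 : (0 < #|{: 'S_n}|)%N by apply/card_gt0P; exists 1%g.
have step_le x : (forall s, safe s x) ->
    uniform_expectation (fun s => phi (step x s))
    <= (1 - h * mu / 2) * phi x + err.
  exact: (epoch_contraction mu_gt0 (ltW G_gt0) gamma_gt0 n_gt0 d_gt0 tdf sf hf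
            scF xs_min grad_le degree_le hL_le hLH_le).
have r_ge0 : 0 <= 1 - h * mu / 2 by lra.
have err_le : err <= (1 - (1 - h * mu / 2)) * c.
  rewrite /c; move: (err) (h * mu) hmu_gt0 => v z z_gt0.
  by rewrite le_eqVlt; apply/orP; left; apply/eqP; field; rewrite gt_eqF.
have start (w : l.-tuple 'S_n) (t : 'I_l) :
    safe (tnth w t) (foldl step x0 (take t w)).
  by move=> k; apply: iterate_le; apply: ltnW.
have := uniform_expectation_foldl_le card_gt0 r_ge0 err_le step_le start.
have -> : (fun w : l.-tuple 'S_n => phi (foldl step x0 w))
  = (fun sigma => enorm (shuffle_output f gamma x0 sigma - xs) ^+ 2).
  apply/funext => w; rewrite /shuffle_output /epoch_start.
  by rewrite take_oversize ?size_tuple.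
move=> main; apply: le_trans main _.
set r := 1 - h * mu / 2 in r_ge0 *.
have c_ge0 : 0 <= c.
  have err_ge0 : 0 <= err.
    by rewrite addr_ge0 // mulr_ge0 ?sqr_ge0 // divr_ge0 // ltW.
  by rewrite mulr_ge0 // divr_ge0 // ltW.
have phi0 : phi x0 <= D ^+ 2.
  have := iterate_le [tuple of nseq l 1%g] (Ordinal l_gt0) 0 (leq0n n).
  rewrite /shuffle_iterate /epoch_prefix take0 /= /epoch_start take0 /= => h0.
  by rewrite /phi lerXn2r ?nnegrE ?enorm_ge0 // ltW.
(* [l * h * mu = 8 * ln T]: this is where the constant of the step size is
   used; the resulting [T ^- 4] is more than enough. *)
have decay : r ^+ l <= 1 / T%:R ^+ 2.
  apply: (@le_trans _ _ (expR (- (h * mu / 2)) ^+ l)).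
    by rewrite lerXn2r ?nnegrE ?expR_ge0 // expR_ge1Dx.
  rewrite -expRM_natl.
  have -> : l%:R * - (h * mu / 2) = - (4 * ln T%:R) :> R.
    by rewrite /h /gamma TE natrM; field; rewrite !gt_eqF // ltr0n.
  apply: (@le_trans _ _ (expR (- (2%:R * ln T%:R)))).
    rewrite ler_expR; lra.
  by rewrite expRN expRM_natl lnK ?posrE // div1r.
apply: (@le_trans _ _ (D ^+ 2 / T%:R ^+ 2 + c)).
  apply: lerD.
    rewrite mulrC -[T%:R ^- 2]div1r; apply: ler_pM phi0 decay.
      exact: sqr_ge0.
    exact: exprn_ge0.
  by rewrite ler_piMl // gerBl exprn_ge0.
rewrite (powR_mulrn 3) ?addr_ge0 ?(ltW lnT_gt0) //.
have rhoE : rho ^+ 2 * n%:R ^+ 3 = m%:R ^+ 2 * n%:R.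
  by rewrite /rho /sparsity -/m; field; rewrite pnatr_eq0 -lt0n.
have rn_ge0 : 0 <= m%:R ^+ 2 * n%:R :> R by apply: mulr_ge0; rewrite ?sqr_ge0.
rewrite rhoE.
apply: le_trans (step_size_rate mu_gt0 (ltW lnT_gt0) T_gt0 C1_ge0 C2_ge0
                   (sqr_ge0 D) rn_ge0).
rewrite lerD2l /c /err.
by apply: fixed_point_le => //; rewrite ?ltr0n ?ler_nat.
Qed.
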